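(* Let $R>r>0$ and $d>0$ with $d^2=R^2-6Rr+r^2$, let $\Gamma,\gamma$ be circles of radii $R,r$ whose centres are at distance $d$, and put $a=\frac1r$, $A=-\frac1R$. For a Steiner $4$-chain with parent circles $\gamma,\Gamma$ and radii $r_1,\dots,r_4$, define its area as $\pi\sum_{j=1}^4 r_j^2$. Over all Steiner $4$-chains with parent circles $\gamma,\Gamma$, the maximum of the area is attained at the axial chain and equals $$\frac{A^4+6A^3a+18A^2a^2+6Aa^3+a^4}{A^2a^2(a+A)^2}\,\pi,$$ and the minimum of the area is attained at the two lateral chains and equals $$\frac{32(3a+A)(a+3A)}{(A-a)^4}\,\pi.$$
   Context: A Steiner $4$-chain with parent circles $\gamma,\Gamma$ (where $\gamma$ lies inside the interior disk of $\Gamma$) is a sequence of circles $\delta_1,\dots,\delta_4$ such that $\delta_i$ and $\delta_{i+1}$ are externally tangent for all $i$ (indices mod $4$), and each $\delta_i$ is externally tangent to $\gamma$ and internally tangent to $\Gamma$. Let $\ell$ be the line through the centres of $\gamma$ and $\Gamma$. The axial chain is the Steiner $4$-chain two of whose circles have centres on $\ell$ (it contains the circle of maximal radius $\frac{R-r+d}{2}$ and the circle of minimal radius $\frac{R-r-d}{2}$). The lateral chains are the two Steiner $4$-chains symmetric with respect to $\ell$ none of whose circles has its centre on $\ell$.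
   Formalization: The four circles of a Steiner 4-chain are required to be distinct (otherwise c,c',c,c' can exceed the stated maximum), and instead of exactly two lateral chains it is shown that at least two exist as labelled sequences (they share the same four circles) and that every lateral chain attains the minimum. *)

(* Defs.v *)
From HB Require Import structures.
From mathcomp Require Export all_boot all_order all_algebra.
From mathcomp Require Export reals trigo.

Set Implicit Arguments.
Unset Strict Implicit.
Unset Printing Implicit Defensive.

Import Order.TTheory GRing.Theory Num.Theory.
Local Open Scope ring_scope.

Definition point (K : realType) : Type := (K * K)%type.

(* The norm instances on pairs and row vectors are sup norms, hence the
   explicit Euclidean distance. *)
Definition dist (K : realType) (p q : point K) : K :=
  Num.sqrt ((p.1 - q.1) ^+ 2 + (p.2 - q.2) ^+ 2).

Record circle (K : realType) := Circle {
  center : point K;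
  radius : K;
  radius_gt0 : 0 < radius
}.

Definition externally_tangent (K : realType) (c c' : circle K) : Prop :=
  dist (center c) (center c') = radius c + radius c'.

(* [c] touches [C] from inside. *)
Definition internally_tangent (K : realType) (c C : circle K) : Prop :=
  radius c < radius C /\ dist (center c) (center C) = radius C - radius c.

(* [c] lies in the open disk bounded by [C]. *)
Definition inside (K : realType) (c C : circle K) : Prop :=
  dist (center c) (center C) + radius c < radius C.

(* [ordS] is the cyclic successor.  The circles of a chain are distinct:
   without injectivity, c, c', c, c' would be a chain as soon as c and c' are
   tangent to each other and to the parent circles. *)
Definition steiner_chain (K : realType) (g G : circle K)
    (delta : 'I_4 -> circle K) : Prop :=
  [/\ inside g G,
      injective delta,
      forall i, externally_tangent (delta i) (delta (ordS i)),
      forall i, externally_tangent (delta i) g &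
      forall i, internally_tangent (delta i) G].

Definition chain_area (K : realType) (delta : 'I_4 -> circle K) : K :=
  pi * \sum_(i < 4) radius (delta i) ^+ 2.

(* [x] is on the line through [p] and [q] (assumed distinct). *)
Definition on_line (K : realType) (p q x : point K) : Prop :=
  exists t : K, x = (p.1 + t * (q.1 - p.1), p.2 + t * (q.2 - p.2)).

(* [x] and [y] are mirror images in the line [pq]: their midpoint is on the
   line and [y - x] is orthogonal to it. *)
Definition mirror_points (K : realType) (p q x y : point K) : Prop :=
  on_line p q ((x.1 + y.1) / 2, (x.2 + y.2) / 2) /\
  (y.1 - x.1) * (q.1 - p.1) + (y.2 - x.2) * (q.2 - p.2) = 0.

Definition mirror_circles (K : realType) (p q : point K) (c c' : circle K) :
    Prop :=
  mirror_points p q (center c) (center c') /\ radius c = radius c'.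

(* Since reflection is an involution, this says that the set of circles of
   the chain is its own mirror image. *)
Definition symmetric_chain (K : realType) (p q : point K)
    (delta : 'I_4 -> circle K) : Prop :=
  forall i, exists j, mirror_circles p q (delta i) (delta j).

Definition axial_chain (K : realType) (g G : circle K)
    (delta : 'I_4 -> circle K) : Prop :=
  steiner_chain g G delta /\
  exists i j, [/\ i != j,
    on_line (center g) (center G) (center (delta i)) &
    on_line (center g) (center G) (center (delta j))].

Definition lateral_chain (K : realType) (g G : circle K)
    (delta : 'I_4 -> circle K) : Prop :=
  [/\ steiner_chain g G delta,
      symmetric_chain (center g) (center G) delta &
      forall i, ~ on_line (center g) (center G) (center (delta i))].

(* Main.v *)
(* A circle tangent to both parent circles has curvature p + q cos(theta), where
   p = (R - r) / (2 R r) and q = d / (2 R r), and two such circles are tangent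
   to each other exactly when their angles differ by a right angle.  So the chains
   are parametrised by one angle theta, and pairing opposite circles turns the
   area into a function of cos^2(theta) sin^2(theta) alone.  This function is
   decreasing on [0, 1/4]; the value 0 is taken at the axial chain and the value
   1/4 at the lateral ones. *)
Require Import Defs.
From mathcomp Require Import all_boot all_order all_algebra.
From mathcomp Require Import reals trigo.
From mathcomp Require Import ring lra.

Import Order.TTheory GRing.Theory Num.Theory.
Local Open Scope ring_scope.

(** * Squared distances and orthogonal unit vectors *)

Section Plane.
Local Set Implicit Arguments.
Local Unset Strict Implicit.
Variable K : realType.
Implicit Types (p q : point K) (c : circle K).

Lemma dist_ge0 p q : 0 <= dist p q.
Proof. exact: sqrtr_ge0. Qed.

Lemma dist_sqr p q :
  dist p q ^+ 2 = (p.1 - q.1) ^+ 2 + (p.2 - q.2) ^+ 2.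
Proof. by rewrite /dist sqr_sqrtr // addr_ge0 // sqr_ge0. Qed.

Lemma dist_eqP p q (l : K) :
  0 <= l -> dist p q = l <-> dist p q ^+ 2 = l ^+ 2.
Proof.
move=> l0; split=> [-> //|/eqP].
by rewrite eqrXn2 ?dist_ge0 // => /eqP.
Qed.

Lemma circle_eq c c' : center c = center c' -> radius c = radius c' -> c = c'.
Proof.
case: c c' => [p l hl] [p' l' hl'] /= -> ell.
by case: l' / ell hl' => hl'; rewrite (bool_irrelevance hl hl').
Qed.

Lemma sum_sqr_eq0 (x y : K) : x ^+ 2 + y ^+ 2 = 0 -> x = 0 /\ y = 0.
Proof.
move=> /eqP; rewrite paddr_eq0 ?sqr_ge0 // !expf_eq0 /=.
by case/andP=> /eqP-> /eqP->.
Qed.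

(** The sign is the determinant [C' * S - S' * C]. Its square is 1 by Lagrange's identity, so either
    vector is a quarter turn of the other. *)
Lemma unit_orthogonal (C S C' S' : K) :
    C ^+ 2 + S ^+ 2 = 1 -> C' ^+ 2 + S' ^+ 2 = 1 -> C * C' + S * S' = 0 ->
  exists2 s : K, s = 1 \/ s = -1 & C = - s * S' /\ S = s * C'.
Proof.
move=> h h' o; exists (C' * S - S' * C); last first.
  split; apply/eqP; rewrite -subr_eq0; apply/eqP.
    transitivity (C * (1 - (C' ^+ 2 + S' ^+ 2)) + C' * (C * C' + S * S')).
      by ring.
    by rewrite h' o; ring.
  transitivity (S * (1 - (C' ^+ 2 + S' ^+ 2)) + S' * (C * C' + S * S')).
    by ring.
  by rewrite h' o; ring.
have /eqP : (C' * S - S' * C) ^+ 2 = 1.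
  transitivity ((C ^+ 2 + S ^+ 2) * (C' ^+ 2 + S' ^+ 2)
                - (C * C' + S * S') ^+ 2); first by ring.
  by rewrite h h' o; ring.
by rewrite sqrf_eq1 => /orP[] /eqP->; [left|right].
Qed.

(** Two quarter turns in a row compose to plus or minus the identity. *)
Lemma unit_orthogonal2 (C S C' S' C'' S'' : K) :
    C ^+ 2 + S ^+ 2 = 1 -> C' ^+ 2 + S' ^+ 2 = 1 -> C'' ^+ 2 + S'' ^+ 2 = 1 ->
    C * C' + S * S' = 0 -> C' * C'' + S' * S'' = 0 ->
  (C'' = C /\ S'' = S) \/ (C'' = - C /\ S'' = - S).
Proof.
move=> h h' h'' o o'.
have [s hs [-> ->]] := unit_orthogonal h h' o.
have [|t ht [-> ->]] := unit_orthogonal h'' h'; first by rewrite -o'; ring.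
case: hs => ->; case: ht => ->; [left|right|right|left]; split; ring.
Qed.

Lemma unit_orthogonal_sqr (C S C' S' : K) :
    C ^+ 2 + S ^+ 2 = 1 -> C' ^+ 2 + S' ^+ 2 = 1 -> C * C' + S * S' = 0 ->
  C' ^+ 2 = S ^+ 2 /\ S' ^+ 2 = C ^+ 2.
Proof.
move=> h h' o; have [s hs [-> ->]] := unit_orthogonal h h' o.
by case: hs => ->; split; ring.
Qed.

End Plane.

(** * The four cyclic indices *)

Local Notation o0 := (@Ordinal 4 0 isT).
Local Notation o1 := (@Ordinal 4 1 isT).
Local Notation o2 := (@Ordinal 4 2 isT).
Local Notation o3 := (@Ordinal 4 3 isT).

(** Reduces to fixed literals, so that hypotheses about [o0], ..., [o3] match syntactically. *)
Lemma forall_ord4 (P : 'I_4 -> Prop) :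
  P o0 -> P o1 -> P o2 -> P o3 -> forall i, P i.
Proof.
move=> P0 P1 P2 P3 [[|[|[|[|//]]]] hi].
- by rewrite (bool_irrelevance hi isT).
- by rewrite (bool_irrelevance hi isT).
- by rewrite (bool_irrelevance hi isT).
- by rewrite (bool_irrelevance hi isT).
Qed.

Lemma ordS4 : [/\ ordS o0 = o1, ordS o1 = o2, ordS o2 = o3 & ordS o3 = o0].
Proof. by split; apply: val_inj. Qed.

(** * Orthonormal coordinates along and across the line of centres *)

Section Frame.
Local Set Implicit Arguments.
Local Unset Strict Implicit.
Variables (K : realType) (G g : circle K).
Local Notation d := (dist (center g) (center G)).
Hypothesis d_gt0 : 0 < d.
Implicit Types p q : point K.

(** The origin is the centre of [g], and the first axis points to the centre of [G]; the two
    coordinates are a dot product and a determinant against that direction. *)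
Definition axial_coord p : K :=
  ((p.1 - (center g).1) * ((center G).1 - (center g).1)
   + (p.2 - (center g).2) * ((center G).2 - (center g).2)) / d.

Definition lateral_coord p : K :=
  ((p.2 - (center g).2) * ((center G).1 - (center g).1)
   - (p.1 - (center g).1) * ((center G).2 - (center g).2)) / d.

(** The inverse of the coordinate map, needed to build circles with prescribed coordinates. *)
Definition frame_point (x y : K) : point K :=
  ((center g).1 + (x * ((center G).1 - (center g).1)
                   - y * ((center G).2 - (center g).2)) / d,
   (center g).2 + (x * ((center G).2 - (center g).2)
                   + y * ((center G).1 - (center g).1)) / d).

Let d_neq0 : d != 0. Proof. exact: lt0r_neq0. Qed.

Let d_sqr : ((center G).1 - (center g).1) ^+ 2
          + ((center G).2 - (center g).2) ^+ 2 = d ^+ 2.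
Proof. by rewrite dist_sqr; ring. Qed.

(** After multiplication by [d ^+ 2] this is the two-square identity: a product of two squared
    lengths is the squared dot product plus the squared determinant. *)
Lemma dist_frame p q :
  dist p q ^+ 2 = (axial_coord p - axial_coord q) ^+ 2
                + (lateral_coord p - lateral_coord q) ^+ 2.
Proof.
rewrite [LHS]dist_sqr /axial_coord /lateral_coord.
apply: (mulIf (expf_neq0 2 d_neq0)).
rewrite -[in LHS]d_sqr; by field.
Qed.

Lemma axial_coord_inner : axial_coord (center g) = 0.
Proof. by rewrite /axial_coord; field. Qed.

Lemma lateral_coord_inner : lateral_coord (center g) = 0.
Proof. by rewrite /lateral_coord; field. Qed.

Lemma axial_coord_outer : axial_coord (center G) = d.
Proof. by rewrite /axial_coord -!expr2 d_sqr; field. Qed.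

Lemma lateral_coord_outer : lateral_coord (center G) = 0.
Proof. by rewrite /lateral_coord; field. Qed.

Lemma axial_coord_frame x y : axial_coord (frame_point x y) = x.
Proof.
apply: (mulIf (expf_neq0 2 d_neq0)); rewrite -[in RHS]d_sqr.
by rewrite /axial_coord /frame_point /=; field.
Qed.

Lemma lateral_coord_frame x y : lateral_coord (frame_point x y) = y.
Proof.
apply: (mulIf (expf_neq0 2 d_neq0)); rewrite -[in RHS]d_sqr.
by rewrite /lateral_coord /frame_point /=; field.
Qed.

Lemma frame_inj p q : axial_coord p = axial_coord q ->
  lateral_coord p = lateral_coord q -> p = q.
Proof.
move=> hx hy; have := dist_frame p q.
rewrite hx hy !subrr [LHS]dist_sqr => h.
have [|/subr0_eq h1 /subr0_eq h2] := @sum_sqr_eq0 _ (p.1 - q.1) (p.2 - q.2).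
  by rewrite h; ring.
by case: p q h1 h2 {hx hy h} => [a b] [a' b'] /= -> ->.
Qed.

Lemma on_lineP p :
  on_line (center g) (center G) p <-> lateral_coord p = 0.
Proof.
split=> [[t ->]|h]; first by rewrite /lateral_coord /=; field.
have line_coord t : axial_coord
    ((center g).1 + t * ((center G).1 - (center g).1),
     (center g).2 + t * ((center G).2 - (center g).2)) = t * d.
  apply: (mulIf d_neq0); rewrite -[RHS]mulrA -expr2 -d_sqr /axial_coord /=.
  by field.
exists (axial_coord p / d); apply: frame_inj; first by
  rewrite line_coord; field.
by rewrite h /lateral_coord /=; field.
Qed.

Lemma mirror_pointsP p q :
  mirror_points (center g) (center G) p q <->
  axial_coord p = axial_coord q /\ lateral_coord q = - lateral_coord p.
Proof.
rewrite /mirror_points on_lineP.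
have -> : lateral_coord ((p.1 + q.1) / 2, (p.2 + q.2) / 2)
        = (lateral_coord p + lateral_coord q) / 2.
  by rewrite /lateral_coord /=; field.
have -> : (q.1 - p.1) * ((center G).1 - (center g).1)
  + (q.2 - p.2) * ((center G).2 - (center g).2)
  = (axial_coord q - axial_coord p) * d by rewrite /axial_coord; field.
split=> [[h /eqP]|[-> ->]]; last by split; ring.
rewrite mulf_eq0 (negPf d_neq0) orbF subr_eq0 => /eqP->; split=> //.
by lra.
Qed.

End Frame.

(** * Circles tangent to both parents, and their phases *)

Section Phases.
Local Set Implicit Arguments.
Local Unset Strict Implicit.
Variables (K : realType) (G g : circle K).
Local Notation R := (radius G).
Local Notation r := (radius g).
Local Notation d := (dist (center g) (center G)).
Hypotheses (d_gt0 : 0 < d) (r_lt_R : r < R).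
Hypothesis d_sqr : d ^+ 2 = R ^+ 2 - 6 * R * r + r ^+ 2.
Local Notation axial := (axial_coord G g).
Local Notation lateral := (lateral_coord G g).
Local Notation w := (Num.sqrt (2 : K)).
Implicit Types (delta : circle K) (C S : K).

(* The inversion making the parent circles concentric sends the circles tangent
   to both onto congruent circles; [(C, S)] is the cosine and sine of the
   position of the image, and [(R - r + d * C) / (2 * R * r)] the curvature. *)
Definition has_phase delta C S : Prop :=
  [/\ C ^+ 2 + S ^+ 2 = 1,
      radius delta * (R - r + d * C) = 2 * R * r,
      axial (center delta) * (R - r + d * C) = - r * (d + (3 * R - r) * C) &
      lateral (center delta) = w * S * radius delta].

Let r_gt0 : 0 < r. Proof. exact: radius_gt0. Qed.
Let R_gt0 : 0 < R. Proof. exact: radius_gt0. Qed.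
Let d_neq0 : d != 0. Proof. exact: lt0r_neq0. Qed.
Let w_gt0 : 0 < w. Proof. by rewrite sqrtr_gt0; lra. Qed.
Let w_sqr : w ^+ 2 = 2. Proof. by rewrite sqr_sqrtr //; lra. Qed.

(** Otherwise [d ^+ 2], which equals [- (R - r) * (3 * r - R) - 2 * R * r - 2 * r ^+ 2], would be
    negative. *)
Lemma three_radii_lt : 3 * r < R.
Proof.
have d2 : 0 < d ^+ 2 by rewrite exprn_gt0.
rewrite ltNge; apply/negP => h; move: d2; rewrite d_sqr.
have h1 : 0 <= (R - r) * (3 * r - R) by rewrite mulr_ge0 // subr_ge0 // ltW.
have h2 : 0 < R * r by rewrite mulr_gt0.
have h3 : 0 < r * r by rewrite mulr_gt0.
by nra.
Qed.

(** The squares differ by [8 * r ^+ 2]. *)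
Lemma dist_lt : d < R - 3 * r.
Proof.
have h := three_radii_lt.
rewrite -(@ltr_pXn2r _ 2) ?nnegrE ?dist_ge0 //; last by lra.
have h1 : 0 < r * r by rewrite mulr_gt0.
by rewrite d_sqr; nra.
Qed.

Lemma unit_bound C S : C ^+ 2 + S ^+ 2 = 1 -> -1 <= C <= 1.
Proof.
move=> h; have s0 := sqr_ge0 S.
by rewrite -ler_norml -(@ler_pXn2r _ 2) ?nnegrE // real_normK ?num_real //; lra.
Qed.

(** Since [C >= -1], the right side is at least [R - r - d]. The bound makes the radius in
    [has_phase] positive and smaller than [R]. *)
Lemma curvature_gt C S : C ^+ 2 + S ^+ 2 = 1 -> 2 * r < R - r + d * C.
Proof.
by move/unit_bound=> /andP[h1 _]; have h2 := dist_lt; have h3 := d_gt0; nra.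
Qed.

Lemma has_phase_exists C S : C ^+ 2 + S ^+ 2 = 1 ->
  exists delta, has_phase delta C S.
Proof.
move=> h; have hD := curvature_gt h.
have D0 : 0 < R - r + d * C by have := r_gt0; lra.
have Dn : R - r + d * C != 0 by exact: lt0r_neq0.
have rho0 : 0 < 2 * R * r / (R - r + d * C) by rewrite divr_gt0 // !mulr_gt0.
exists (Circle (frame_point G g (- r * (d + (3 * R - r) * C) / (R - r + d * C))
  (w * S * (2 * R * r / (R - r + d * C)))) rho0).
split=> //=.
- by field.
- by rewrite axial_coord_frame //; field.
- by rewrite lateral_coord_frame.
Qed.

Lemma has_phase_inj delta delta' C S :
  has_phase delta C S -> has_phase delta' C S -> delta = delta'.
Proof.
move=> [h hr hx hy] [_ hr' hx' hy']; have hD := curvature_gt h.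
have Dn : R - r + d * C != 0 by apply: lt0r_neq0; have := r_gt0; lra.
have hrr : radius delta = radius delta' by apply: (mulIf Dn); rewrite hr hr'.
apply: circle_eq => //; apply: (@frame_inj _ G g) => //.
  by apply: (mulIf Dn); rewrite hx hx'.
by rewrite hy hy' hrr.
Qed.

(** This is external tangency to [g], squared. With denominators cleared, the two sides differ by a
    multiple of the hypothesis on [d ^+ 2]. *)
Lemma has_phase_center_sqr delta C S : has_phase delta C S ->
  axial (center delta) ^+ 2 + lateral (center delta) ^+ 2
  = (r + radius delta) ^+ 2.
Proof.
move=> [h hr hx ->]; have hD := curvature_gt h.
have Dn : R - r + d * C != 0 by apply: lt0r_neq0; have := r_gt0; lra.
apply: (mulIf (expf_neq0 2 Dn)).
transitivity ((axial (center delta) * (R - r + d * C)) ^+ 2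
   + w ^+ 2 * S ^+ 2 * (radius delta * (R - r + d * C)) ^+ 2); first by ring.
transitivity ((r * (R - r + d * C) + (radius delta * (R - r + d * C))) ^+ 2);
  last by ring.
rewrite hx hr w_sqr (_ : S ^+ 2 = 1 - C ^+ 2); last by rewrite -h; ring.
apply/eqP; rewrite -subr_eq0; apply/eqP.
transitivity (r ^+ 2 * (1 - C ^+ 2) *
  (d ^+ 2 - (R ^+ 2 - 6 * R * r + r ^+ 2))); first by ring.
by rewrite d_sqr; ring.
Qed.

(** This is the difference of the two squared tangency conditions, in which the quadratic terms
    cancel; with [has_phase_center_sqr] it yields tangency to [G]. *)
Lemma has_phase_axial delta C S : has_phase delta C S ->
  axial (center delta) * d = r * (r - 3 * R) + radius delta * (R + r).
Proof.
move=> [h hr hx _]; have hD := curvature_gt h.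
have Dn : R - r + d * C != 0 by apply: lt0r_neq0; have := r_gt0; lra.
apply: (mulIf Dn).
transitivity (r * (r - 3 * R) * (R - r + d * C)
  + radius delta * (R - r + d * C) * (R + r)); last by ring.
rewrite mulrAC hx hr.
apply/eqP; rewrite -subr_eq0; apply/eqP.
transitivity (- r * (d ^+ 2 - (R ^+ 2 - 6 * R * r + r ^+ 2))); first by ring.
by rewrite d_sqr; ring.
Qed.

Lemma has_phase_tangent delta C S : has_phase delta C S ->
  externally_tangent delta g /\ internally_tangent delta G.
Proof.
move=> ph; have rho0 := radius_gt0 delta.
have hs := has_phase_center_sqr ph; have ha := has_phase_axial ph.
case: ph => h hr _ _; have hD := curvature_gt h.
have rho_lt : radius delta < R.
  rewrite -(ltr_pM2r (_ : 0 < 2 * r)) ?mulr_gt0 //.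
  by rewrite [R * _]mulrCA mulrA -hr ltr_pM2l.
split; last split=> //; apply/dist_eqP.
- by rewrite addr_ge0 // ltW.
- rewrite (dist_frame d_gt0) axial_coord_inner // lateral_coord_inner // !subr0.
  by rewrite hs; ring.
- by rewrite subr_ge0 ltW.
- rewrite (dist_frame d_gt0) axial_coord_outer // lateral_coord_outer // subr0.
  transitivity (axial (center delta) ^+ 2 + lateral (center delta) ^+ 2
    - 2 * (axial (center delta) * d) + d ^+ 2); first by ring.
  by rewrite hs ha d_sqr; ring.
Qed.

Lemma tangent_has_phase delta : externally_tangent delta g ->
  internally_tangent delta G -> exists C S, has_phase delta C S.
Proof.
have rho0 := radius_gt0 delta.
have rhon : radius delta != 0 by exact: lt0r_neq0.
move=> hg [rho_lt hG].
have {}hg : dist (center delta) (center g) ^+ 2 = (radius delta + r) ^+ 2.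
  by rewrite hg.
have {}hG : dist (center delta) (center G) ^+ 2 = (R - radius delta) ^+ 2.
  by rewrite hG.
rewrite (dist_frame d_gt0) axial_coord_inner // lateral_coord_inner // !subr0
  in hg.
rewrite (dist_frame d_gt0) axial_coord_outer // lateral_coord_outer // subr0
  in hG.
have ha : axial (center delta) * d = r * (r - 3 * R) + radius delta * (R + r).
  have : axial (center delta) ^+ 2 + lateral (center delta) ^+ 2
    - 2 * (axial (center delta) * d) + d ^+ 2 = (R - radius delta) ^+ 2.
    by rewrite -hG; ring.
  by rewrite hg d_sqr; lra.
(* [C] solves the radius equation of [has_phase] and [S] the lateral one; the unit norm and the
   axial equation remain to be checked. *)
pose C := (2 * R * r / radius delta - (R - r)) / d.
pose S := lateral (center delta) / (w * radius delta).
have hD : R - r + d * C = 2 * R * r / radius delta.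
  by rewrite /C; field; rewrite rhon.
have wn : w != 0 by exact: lt0r_neq0.
exists C, S; split.
- apply: (mulIf (mulf_neq0 (expf_neq0 2 wn)
                          (expf_neq0 2 (mulf_neq0 d_neq0 rhon)))).
  (* The last parenthesis is [d ^+ 2] times the squared lateral coordinate, arranged so that [hg]
     and [ha] apply. *)
  transitivity (w ^+ 2 * (2 * R * r - (R - r) * radius delta) ^+ 2
    + ((axial (center delta) ^+ 2 + lateral (center delta) ^+ 2) * d ^+ 2
       - (axial (center delta) * d) ^+ 2)).
    by rewrite /C /S; field; rewrite wn rhon.
  by rewrite hg ha w_sqr [(d * _) ^+ 2]exprMn d_sqr; ring.
- by rewrite hD; field.
- rewrite hD; apply: (mulIf d_neq0); rewrite mulrAC ha.
  transitivity (- r * (d ^+ 2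
    + (3 * R - r) * (2 * R * r / radius delta - (R - r)))).
    by rewrite d_sqr; field.
  by rewrite /C; field; rewrite rhon d_neq0.
- by rewrite /S; field; rewrite rhon wn.
Qed.

Lemma phases_tangent delta delta' C S C' S' :
    has_phase delta C S -> has_phase delta' C' S' ->
  externally_tangent delta delta' <-> C * C' + S * S' = 0.
Proof.
move=> ph ph'; have rho0 := radius_gt0 delta; have rho0' := radius_gt0 delta'.
rewrite /externally_tangent dist_eqP ?addr_ge0 ?ltW // (dist_frame d_gt0).
have hs := has_phase_center_sqr ph; have hs' := has_phase_center_sqr ph'.
case: ph ph' => [h hr hx hy] [h' hr' hx' hy'].
have hD := curvature_gt h; have hD' := curvature_gt h'.
have D0 : 0 < R - r + d * C by have := r_gt0; lra.
have D0' : 0 < R - r + d * C' by have := r_gt0; lra.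
set x := axial _ in hs hx *; set x' := axial _ in hs' hx' *.
set y := lateral _ in hs hy *; set y' := lateral _ in hs' hy' *.
set rho := radius delta in hs hr hy *.
set rho' := radius delta' in hs' hr' hy' *.
set D := R - r + d * C in hr hx D0; set D' := R - r + d * C' in hr' hx' D0'.
(* The defect from tangency is a nonzero multiple of the dot product of the phases, which settles
   both directions. *)
have key : ((x - x') ^+ 2 + (y - y') ^+ 2 - (rho + rho') ^+ 2) * (D * D')
    = -16 * R ^+ 2 * r ^+ 2 * (C * C' + S * S').
  transitivity (((x ^+ 2 + y ^+ 2) + (x' ^+ 2 + y' ^+ 2)
    - (rho + rho') ^+ 2 - 2 * (x * x' + y * y')) * (D * D')); first by ring.
  rewrite hs hs' hy hy'.
  transitivity (2 * (r ^+ 2 * D * D' + r * (rho * D) * D' + r * (rho' * D') * D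
    - (rho * D) * (rho' * D') - (x * D) * (x' * D')
    - w ^+ 2 * S * S' * (rho * D) * (rho' * D'))); first by ring.
  rewrite hr hr' hx hx' w_sqr /D /D'.
  apply/eqP; rewrite -subr_eq0; apply/eqP.
  transitivity (2 * r ^+ 2 * (C * C' - 1) *
    (d ^+ 2 - (R ^+ 2 - 6 * R * r + r ^+ 2))); first by ring.
  by rewrite d_sqr; ring.
have DDn : D * D' != 0 by rewrite mulf_neq0 // lt0r_neq0.
have cn : -16 * R ^+ 2 * r ^+ 2 != 0.
  by apply: ltr0_neq0; rewrite !mulNr oppr_lt0 !mulr_gt0 ?exprn_gt0.
split=> [e|e].
  by apply: (mulfI cn); rewrite -key e subrr mul0r mulr0.
apply/eqP; rewrite -subr_eq0; apply/eqP.
by apply: (mulIf DDn); rewrite key e mulr0 mul0r.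
Qed.

Lemma inside_parents : inside g G.
Proof. by rewrite /inside; have := dist_lt; have := r_gt0; lra. Qed.

Lemma has_phase_on_line delta C S : has_phase delta C S ->
  on_line (center g) (center G) (center delta) <-> S = 0.
Proof.
move=> [_ _ _ hy]; rewrite on_lineP // hy; split=> [/eqP|->]; last by ring.
by rewrite !mulf_eq0 (gt_eqF w_gt0) (gt_eqF (radius_gt0 delta)) orbF => /eqP.
Qed.

(** Reflection keeps the radius, hence [C], and negates the lateral coordinate, hence [S]. *)
Lemma has_phase_mirror delta delta' C S C' S' :
    has_phase delta C S -> has_phase delta' C' S' ->
  mirror_circles (center g) (center G) delta delta' <-> C' = C /\ S' = - S.
Proof.
move=> [h hr hx hy] [h' hr' hx' hy']; rewrite /mirror_circles mirror_pointsP //.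
have rho0' := lt0r_neq0 (radius_gt0 delta').
split=> [[[_ hm] hrr]|[eC eS]].
  split.
    have : R - r + d * C = R - r + d * C'.
      by apply: (mulfI rho0'); rewrite hr' -hrr hr.
    by move/addrI/(mulfI d_neq0).
  apply: (mulIf rho0'); apply: (mulfI (lt0r_neq0 w_gt0)).
  by rewrite mulrA -hy' hm hy hrr; ring.
have Dn : R - r + d * C != 0.
  by apply: lt0r_neq0; have := r_gt0; have := curvature_gt h; lra.
rewrite eC in hr' hx'.
have hrr : radius delta = radius delta' by apply: (mulIf Dn); rewrite hr hr'.
split=> //; split; first by apply: (mulIf Dn); rewrite hx hx'.
by rewrite hy hy' eS hrr; ring.
Qed.

(** Used to separate circles: phases with dot product other than 1 belong to distinct circles. *)
Lemma has_phase_dot delta delta' C S C' S' :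
    has_phase delta C S -> has_phase delta' C' S' -> delta = delta' ->
  C * C' + S * S' = 1.
Proof.
move=> [h hr _ hy] [_ hr' _ hy'] e; subst delta'.
have rho0 := lt0r_neq0 (radius_gt0 delta).
have -> : C' = C.
  have /(mulfI rho0) : radius delta * (R - r + d * C')
    = radius delta * (R - r + d * C) by rewrite hr hr'.
  by move/addrI/(mulfI d_neq0).
have -> : S' = S.
  by move: hy; rewrite hy' => /(mulIf rho0)/(mulfI (lt0r_neq0 w_gt0)).
by rewrite -!expr2.
Qed.

(** * Chains as pairs of orthogonal phases *)

Definition chain_phases (delta : 'I_4 -> circle K) C S C' S' : Prop :=
  C * C' + S * S' = 0 /\
  [/\ has_phase (delta o0) C S, has_phase (delta o1) C' S',
      has_phase (delta o2) (- C) (- S) & has_phase (delta o3) (- C') (- S')].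

(* Consecutive phases are orthogonal, so circles two apart have equal or
   opposite phases; injectivity excludes equality. *)
Lemma steiner_chain_phases (delta : 'I_4 -> circle K) :
  steiner_chain g G delta -> exists C S C' S', chain_phases delta C S C' S'.
Proof.
move=> [_ inj tan tang tanG].
have [C [S p0]] := tangent_has_phase (tang o0) (tanG o0).
have [C' [S' p1]] := tangent_has_phase (tang o1) (tanG o1).
have [C2 [S2 p2]] := tangent_has_phase (tang o2) (tanG o2).
have [C3 [S3 p3]] := tangent_has_phase (tang o3) (tanG o3).
have [e0 e1 e2 _] := ordS4.
have := tan o0; rewrite e0 (phases_tangent p0 p1) => t01.
have := tan o1; rewrite e1 (phases_tangent p1 p2) => t12.
have := tan o2; rewrite e2 (phases_tangent p2 p3) => t23.
exists C, S, C', S'; split=> //.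
have [u0 _ _ _] := p0; have [u1 _ _ _] := p1.
have [u2 _ _ _] := p2; have [u3 _ _ _] := p3.
case: (unit_orthogonal2 u0 u1 u2 t01 t12) => [] [eC2 eS2]; subst C2 S2.
  by have /inj := has_phase_inj p0 p2.
case: (unit_orthogonal2 u1 u2 u3 t12 t23) => [] [eC3 eS3]; subst C3 S3 => //.
by have /inj := has_phase_inj p1 p3.
Qed.

Lemma chain_phases_steiner (delta : 'I_4 -> circle K) C S C' S' :
  chain_phases delta C S C' S' -> steiner_chain g G delta.
Proof.
move=> [o [p0 p1 p2 p3]].
have [e0 e1 e2 e3] := ordS4.
have tan i : externally_tangent (delta i) (delta (ordS i)).
  move: i; apply: forall_ord4; rewrite ?e0 ?e1 ?e2 ?e3.
  - by rewrite (phases_tangent p0 p1).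
  - by rewrite (phases_tangent p1 p2) -oppr0 -o; ring.
  - by rewrite (phases_tangent p2 p3) -o; ring.
  - by rewrite (phases_tangent p3 p0) -oppr0 -o; ring.
have tanp i : externally_tangent (delta i) g /\ internally_tangent (delta i) G.
  move: i; apply: forall_ord4;
  by [exact: has_phase_tangent p0 | exact: has_phase_tangent p1
     |exact: has_phase_tangent p2 | exact: has_phase_tangent p3].
split=> //; first exact: inside_parents.
- have [u0 _ _ _] := p0; have [u1 _ _ _] := p1.
  (* Equal circles would have phases with dot product 1, but two different members of the chain have
     dot product 0 or -1. *)
  do 2!apply: forall_ord4 => //;
    (first [ move/(has_phase_dot p0 p1) | move/(has_phase_dot p0 p2)
           | move/(has_phase_dot p0 p3) | move/(has_phase_dot p1 p0)
           | move/(has_phase_dot p1 p2) | move/(has_phase_dot p1 p3)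
           | move/(has_phase_dot p2 p0) | move/(has_phase_dot p2 p1)
           | move/(has_phase_dot p2 p3) | move/(has_phase_dot p3 p0)
           | move/(has_phase_dot p3 p1) | move/(has_phase_dot p3 p2) ]) => h;
    exfalso; lra.
- by move=> i; case: (tanp i).
- by move=> i; case: (tanp i).
Qed.

(** * The area as a function of one parameter *)

(* For a chain of phases [(C, S), (C', S'), ...] with
   [P = (R - r)^2 - (d C)^2] and [Q = (R - r)^2 - (d C')^2], one has
   [P + Q = (R + r)^2], and [z] is [1 / (P Q)] at [t = C^2 S^2]. *)
Definition area_profile (t : K) : K :=
  let z := (4 * R * r * (R - r) ^+ 2 + d ^+ 4 * t)^-1 in
  8 * R ^+ 2 * r ^+ 2 *
  (2 * (R - r) ^+ 2 * ((R + r) ^+ 4 * z ^+ 2 - 2 * z) - (R + r) ^+ 2 * z).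

(** With [k = R - r], two opposite circles contribute [4 R^2 r^2 (4 k^2 / P^2 - 2 / P)], and
    likewise with [Q]. The sum is symmetric in [P] and [Q], so it depends only on [P + Q] and
    [P Q]. *)
Lemma chain_area_phases (delta : 'I_4 -> circle K) C S C' S' :
    chain_phases delta C S C' S' ->
  chain_area delta = pi * area_profile (C ^+ 2 * S ^+ 2).
Proof.
move=> [o [p0 p1 p2 p3]]; rewrite /chain_area; congr (_ * _).
have rad delta0 C0 S0 : has_phase delta0 C0 S0 ->
    R - r + d * C0 != 0 /\ radius delta0 = 2 * R * r / (R - r + d * C0).
  move=> [h hr _ _]; have Dn : R - r + d * C0 != 0.
    by apply: lt0r_neq0; have := r_gt0; have := curvature_gt h; lra.
  by split=> //; apply: (mulIf Dn); rewrite hr divfK.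
have [n0 r0] := rad _ _ _ p0; have [n1 r1] := rad _ _ _ p1.
have [n2 r2] := rad _ _ _ p2; have [n3 r3] := rad _ _ _ p3.
have [u0 _ _ _] := p0; have [u1 _ _ _] := p1.
have [eC eS] := unit_orthogonal_sqr u0 u1 o.
transitivity (radius (delta o0) ^+ 2 + radius (delta o1) ^+ 2
   + radius (delta o2) ^+ 2 + radius (delta o3) ^+ 2).
  rewrite !big_ord_recr big_ord0 /= add0r.
  by do 3?congr (_ + _); congr (radius (delta _) ^+ 2); apply: val_inj.
rewrite r0 r1 r2 r3 /area_profile.
have dd : d ^+ 4 = (d ^+ 2) ^+ 2 by rewrite -exprM.
have hC' : d ^+ 2 * C' ^+ 2 = d ^+ 2 - d ^+ 2 * C ^+ 2.
  by rewrite eC (_ : S ^+ 2 = 1 - C ^+ 2); [ring|rewrite -u0; ring].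
have hT : (R + r) ^+ 2 = ((R - r) ^+ 2 - (d * C) ^+ 2)
                       + ((R - r) ^+ 2 - (d * C') ^+ 2).
  by rewrite [(d * C') ^+ 2]exprMn hC' exprMn d_sqr; ring.
have hN : 4 * R * r * (R - r) ^+ 2 + d ^+ 4 * (C ^+ 2 * S ^+ 2)
    = ((R - r) ^+ 2 - (d * C) ^+ 2) * ((R - r) ^+ 2 - (d * C') ^+ 2).
  transitivity ((R - r) ^+ 2 * ((R - r) ^+ 2 - d ^+ 2)
    + (d ^+ 2 * C ^+ 2) * (d ^+ 2 * C' ^+ 2)).
    by rewrite eC dd d_sqr; ring.
  by rewrite !exprMn hC'; ring.
rewrite hN (exprM (R + r) 2 2) hT.
move: n2 n3; rewrite !mulrN => n2 n3.
have hP : (R - r) ^+ 2 - (d * C) ^+ 2 != 0 by rewrite subr_sqr mulf_neq0.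
have hQ : (R - r) ^+ 2 - (d * C') ^+ 2 != 0 by rewrite subr_sqr mulf_neq0.
by field; rewrite n0 n1 n2 n3 hP hQ.
Qed.

(** The profile is a quadratic in [z], and [z] decreases in [t]. The difference of two values has
    the factor [z - z']; the cofactor is nonnegative because [(R + r) ^+ 4 * z >= 4] at both
    points. *)
Lemma area_profile_decr (s t : K) : 0 <= s -> s <= t -> t <= 4^-1 ->
  area_profile t <= area_profile s.
Proof.
move=> s0 st t4; rewrite /area_profile /=.
pose N (x : K) := 4 * R * r * (R - r) ^+ 2 + d ^+ 4 * x.
have h3 := three_radii_lt.
have dd : d ^+ 4 = (d ^+ 2) ^+ 2 by rewrite -exprM.
have d4 : 0 < d ^+ 4 by rewrite exprn_gt0.
have T0 : 0 < (R + r) ^+ 4 by rewrite exprn_gt0 // addr_gt0.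
have N0 : 0 < N s.
  apply: ltr_pwDl; last by rewrite mulr_ge0 // ltW.
  by rewrite !mulr_gt0 // subr_gt0.
have Nst : N s <= N t by rewrite lerD2l ler_pM2l.
have Nt : N t <= (R + r) ^+ 4 / 4.
  (* At [1 / 4] the factors [P] and [Q] are both [(R + r) ^+ 2 / 2]. *)
  have -> : (R + r) ^+ 4 / 4 = N 4^-1 by rewrite /N dd d_sqr; field.
  by rewrite lerD2l ler_pM2l.
have Nt0 : 0 < N t by exact: lt_le_trans N0 Nst.
have -> : 4 * R * r * (R - r) ^+ 2 + d ^+ 4 * s = N s by [].
have -> : 4 * R * r * (R - r) ^+ 2 + d ^+ 4 * t = N t by [].
have zst : (N t)^-1 <= (N s)^-1 by rewrite lef_pV2.
have zt : 4 <= (R + r) ^+ 4 * (N t)^-1.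
  by rewrite ler_pdivlMr // mulrC -ler_pdivlMr.
move: (N s)^-1 (N t)^-1 zst zt => z z' zz z'4.
rewrite ler_pM2l ?mulr_gt0 ?exprn_gt0 // -subr_ge0.
rewrite (_ : _ - _ = (z - z') * (2 * (R - r) ^+ 2 * ((R + r) ^+ 4 * z
  + (R + r) ^+ 4 * z') - 4 * (R - r) ^+ 2 - (R + r) ^+ 2)); last by ring.
have z4 : 4 <= (R + r) ^+ 4 * z by apply: le_trans z'4 _; rewrite ler_pM2l.
apply: mulr_ge0; first by rewrite subr_ge0.
rewrite -addrA -opprD subr_ge0.
(* From [3 * r < R] one gets [R + r < 2 * (R - r)], so [(R + r) ^+ 2] is below
   [12 * (R - r) ^+ 2]. *)
apply: (@le_trans _ _ (2 * (R - r) ^+ 2 * 8)); first by have := r_gt0; nra.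
by rewrite ler_pM2l; [lra | rewrite !mulr_gt0 // subr_gt0].
Qed.

Lemma area_profile0 :
  let a : K := 1 / r in
  let A : K := - (1 / R) in
  area_profile 0 = (A ^+ 4 + 6 * A ^+ 3 * a + 18 * A ^+ 2 * a ^+ 2
            + 6 * A * a ^+ 3 + a ^+ 4)
           / (A ^+ 2 * a ^+ 2 * (a + A) ^+ 2).
Proof.
have Rn : R != 0 by exact: lt0r_neq0.
have rn : r != 0 by exact: lt0r_neq0.
have Rrn : R - r != 0 by rewrite subr_eq0 gt_eqF.
rewrite /area_profile mulr0 addr0 /=; field.
by rewrite Rn rn mulN1r.
Qed.

Lemma area_profile_quarter :
  let a : K := 1 / r in
  let A : K := - (1 / R) in
  area_profile 4^-1 = 32 * (3 * a + A) * (a + 3 * A) / (A - a) ^+ 4.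
Proof.
have Rn : R != 0 by exact: lt0r_neq0.
have rn : r != 0 by exact: lt0r_neq0.
have Rrn : R + r != 0 by rewrite lt0r_neq0 // addr_gt0.
rewrite /area_profile.
have -> : 4 * R * r * (R - r) ^+ 2 + d ^+ 4 * 4^-1 = (R + r) ^+ 4 / 4.
  by rewrite (exprM d 2 2) d_sqr; field.
move=> /=; field.
by rewrite Rn rn Rrn !mulN1r -opprD oppr_eq0 addrC Rrn.
Qed.

(** * Axial and lateral chains *)

(** Steiner's porism: from any starting phase, successive quarter turns close up after four
    steps. *)
Lemma chain_phases_exists C S : C ^+ 2 + S ^+ 2 = 1 ->
  exists delta : 'I_4 -> circle K, chain_phases delta C S (- S) C.
Proof.
move=> u.
have [d0 p0] := has_phase_exists u.
have [|d1 p1] := @has_phase_exists (- S) C; first by rewrite -u; ring.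
have [|d2 p2] := @has_phase_exists (- C) (- S); first by rewrite -u; ring.
(* The double negation is kept to match [- C'] with [C' = - S]. *)
have [|d3 p3] := @has_phase_exists (- - S) (- C); first by rewrite -u; ring.
exists (fun i => nth d0 [:: d0; d1; d2; d3] i).
by split; first by ring.
Qed.

Lemma chain_phases_axial (delta : 'I_4 -> circle K) C' S' :
  chain_phases delta 1 0 C' S' -> axial_chain g G delta.
Proof.
move=> ph; split; first exact: chain_phases_steiner ph.
case: ph => _ [p0 _ p2 _]; exists o0, o2; split=> //.
  by rewrite (has_phase_on_line p0).
by rewrite (has_phase_on_line p2) oppr0.
Qed.

Lemma axial_chain_phases (delta : 'I_4 -> circle K) : axial_chain g G delta ->
  exists C S C' S', chain_phases delta C S C' S' /\ C ^+ 2 * S ^+ 2 = 0.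
Proof.
move=> [/steiner_chain_phases[C [S [C' [S' ph]]]] [i [_ [_ li _]]]].
exists C, S, C', S'; split=> //; case: ph => o [p0 p1 p2 p3].
have [u0 _ _ _] := p0; have [u1 _ _ _] := p1.
(* Replacing [C ^+ 2] by [S' ^+ 2] makes the product vanish whichever circle is on the line. *)
have [_ <-] := unit_orthogonal_sqr u0 u1 o.
move: i li; apply: forall_ord4.
- by rewrite (has_phase_on_line p0) => ->; ring.
- by rewrite (has_phase_on_line p1) => ->; ring.
- by rewrite (has_phase_on_line p2) => /eqP; rewrite oppr_eq0 => /eqP->; ring.
- by rewrite (has_phase_on_line p3) => /eqP; rewrite oppr_eq0 => /eqP->; ring.
Qed.

Lemma chain_phases_lateral (delta : 'I_4 -> circle K) C S C' S' :
  chain_phases delta C S C' S' -> C ^+ 2 = S ^+ 2 -> lateral_chain g G delta.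
Proof.
move=> ph hCS.
have st := chain_phases_steiner ph; case: ph => o [p0 p1 p2 p3].
have [u0 _ _ _] := p0; have [u1 _ _ _] := p1.
have C0 : C != 0.
  apply/eqP => e; move: u0; rewrite -hCS e expr0n addr0 => /eqP.
  by rewrite eq_sym oner_eq0.
have S0 : S != 0 by rewrite -sqrf_eq0 -hCS sqrf_eq0.
have S'0 : S' != 0.
  by have [_ eS] := unit_orthogonal_sqr u0 u1 o; rewrite -sqrf_eq0 eS sqrf_eq0.
split=> //; last first.
  apply: forall_ord4.
  - by rewrite (has_phase_on_line p0); apply/eqP.
  - by rewrite (has_phase_on_line p1); apply/eqP.
  - by rewrite (has_phase_on_line p2); apply/eqP; rewrite oppr_eq0.
  - by rewrite (has_phase_on_line p3); apply/eqP; rewrite oppr_eq0.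
(* The mirror image [(C, - S)] of the first phase is the second or the fourth phase; the reflection
   then swaps neighbours in pairs, in one of two ways. *)
have h01 : C' = C -> S' = - S -> symmetric_chain (center g) (center G) delta.
  move=> eC eS; apply: forall_ord4; [exists o1|exists o0|exists o3|exists o2].
  - by rewrite (has_phase_mirror p0 p1).
  - by rewrite (has_phase_mirror p1 p0) eC eS opprK.
  - by rewrite (has_phase_mirror p2 p3) eC eS.
  - by rewrite (has_phase_mirror p3 p2) eC eS !opprK.
have h03 : C' = - C -> S' = S -> symmetric_chain (center g) (center G) delta.
  move=> eC eS; apply: forall_ord4; [exists o3|exists o2|exists o1|exists o0].
  - by rewrite (has_phase_mirror p0 p3) eC eS opprK.
  - by rewrite (has_phase_mirror p1 p2) eC eS.
  - by rewrite (has_phase_mirror p2 p1) eC eS opprK.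
  - by rewrite (has_phase_mirror p3 p0) eC eS !opprK.
have [|t ht [eC' eS']] := unit_orthogonal u1 u0; first by rewrite -o; ring.
move/eqP: hCS; rewrite eqf_sqr => /orP[] /eqP hCS.
  case: ht => et; [apply: h03|apply: h01]; rewrite ?eC' ?eS' et hCS; ring.
case: ht => et; [apply: h01|apply: h03]; rewrite ?eC' ?eS' et hCS; ring.
Qed.

(** The mirror image of the first circle is neither itself nor its opposite, since [S = 0] or
    [C = 0] would put a centre on the line. So it is a neighbour, and orthogonality becomes
    [C ^+ 2 = S ^+ 2]. *)
Lemma lateral_chain_phases (delta : 'I_4 -> circle K) :
    lateral_chain g G delta ->
  exists C S C' S', chain_phases delta C S C' S' /\ C ^+ 2 * S ^+ 2 = 4^-1.
Proof.
move=> [/steiner_chain_phases[C [S [C' [S' ph]]]] sym nl].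
exists C, S, C', S'; split=> //; case: ph => o [p0 p1 p2 p3].
have [u0 _ _ _] := p0; have [u1 _ _ _] := p1.
have S0 : S <> 0 by move=> e; apply: (nl o0); rewrite (has_phase_on_line p0).
have S'0 : S' <> 0 by move=> e; apply: (nl o1); rewrite (has_phase_on_line p1).
have [_ eS] := unit_orthogonal_sqr u0 u1 o.
suff hCS : C ^+ 2 = S ^+ 2.
  have -> : C ^+ 2 = 2^-1 by lra.
  have -> : S ^+ 2 = 2^-1 by lra.
  by field.
have [j] := sym o0; move: j; apply: forall_ord4.
- by rewrite (has_phase_mirror p0 p0) => -[_ e]; case: S0; lra.
- by rewrite (has_phase_mirror p0 p1) => -[e e']; rewrite e e' in o; lra.
- rewrite (has_phase_mirror p0 p2) => -[e _]; case: S'0.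
  by apply/eqP; rewrite -sqrf_eq0 eS sqrf_eq0; apply/eqP; lra.
- rewrite (has_phase_mirror p0 p3) => -[/eqP e /eqP e'].
  move: e e'; rewrite eqr_oppLR eqr_opp => /eqP e /eqP e'.
  by rewrite e e' in o; lra.
Qed.

Lemma phase_product_bound C S : C ^+ 2 + S ^+ 2 = 1 ->
  0 <= C ^+ 2 * S ^+ 2 <= 4^-1.
Proof.
move=> h; rewrite mulr_ge0 ?sqr_ge0 //=.
have := sqr_ge0 (C ^+ 2 - S ^+ 2); rewrite (_ : S ^+ 2 = 1 - C ^+ 2); last lra.
by nra.
Qed.

End Phases.

(** * The extremal areas *)

Theorem theorem2 (K : realType) (R r d : K) (G g : circle K)
    (hr : 0 < r) (hrR : r < R) (hd : 0 < d)
    (hRrd : d ^+ 2 = R ^+ 2 - 6 * R * r + r ^+ 2)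
    (hG : radius G = R) (hg : radius g = r)
    (hdist : dist (center g) (center G) = d) :
  let a : K := 1 / r in
  let A : K := - (1 / R) in
  let M : K := (A ^+ 4 + 6 * A ^+ 3 * a + 18 * A ^+ 2 * a ^+ 2
            + 6 * A * a ^+ 3 + a ^+ 4)
           / (A ^+ 2 * a ^+ 2 * (a + A) ^+ 2) * pi in
  let m : K := 32 * (3 * a + A) * (a + 3 * A) / (A - a) ^+ 4 * pi in
  [/\ forall delta, steiner_chain g G delta -> chain_area delta <= M,
      exists delta, axial_chain g G delta &
      forall delta, axial_chain g G delta -> chain_area delta = M] /\
  [/\ forall delta, steiner_chain g G delta -> m <= chain_area delta,
      exists delta delta', [/\ lateral_chain g G delta,
                               lateral_chain g G delta' & delta <> delta'] &
      forall delta, lateral_chain g G delta -> chain_area delta = m].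
Proof.
move=> a A M m; subst R r d.
have eM : M = pi * area_profile G g 0.
  by rewrite area_profile0 // mulrC.
have em : m = pi * area_profile G g 4^-1.
  by rewrite area_profile_quarter // mulrC.
rewrite {}eM {}em {a A M m}; have pi0 := @pi_gt0 K.
split; split.
- move=> delta /steiner_chain_phases[] // C [S [C' [S' ph]]].
  have [_ [[u _ _ _] _ _ _]] := ph; have /andP[h1 h2] := phase_product_bound u.
  by rewrite (chain_area_phases _ _ _ ph) // ler_pM2l // area_profile_decr.
- have [|delta ph] := @chain_phases_exists _ _ _ hd hrR hRrd 1 0; first by ring.
  by exists delta; apply: chain_phases_axial ph.
- move=> delta /axial_chain_phases[] // C [S [C' [S' [ph e]]]].
  by rewrite (chain_area_phases _ _ _ ph) // e.
- move=> delta /steiner_chain_phases[] // C [S [C' [S' ph]]].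
  have [_ [[u _ _ _] _ _ _]] := ph; have /andP[h1 h2] := phase_product_bound u.
  by rewrite (chain_area_phases _ _ _ ph) // ler_pM2l // area_profile_decr.
(* The starting phases [(c, c)] and [(c, - c)] lie at 45 degrees on either side of the axis. *)
- pose c : K := Num.sqrt 2^-1.
  have c2 : c ^+ 2 = 2^-1 by rewrite sqr_sqrtr // invr_ge0.
  have u : c ^+ 2 + c ^+ 2 = 1 by rewrite c2; field.
  have u' : c ^+ 2 + (- c) ^+ 2 = 1 by rewrite sqrrN.
  have [delta ph] := chain_phases_exists hd hrR hRrd u.
  have [delta' ph'] := chain_phases_exists hd hrR hRrd u'.
  exists delta, delta'; split.
  + exact: chain_phases_lateral ph _.
  + by apply: chain_phases_lateral ph' _ => //; rewrite sqrrN.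
  (* As indexed sequences the two chains differ in their first circles, whose phases have dot
     product 0 and not 1. *)
  move=> e; have [_ [p0 _ _ _]] := ph; have [_ [p0' _ _ _]] := ph'.
  have /eqP := has_phase_dot hd p0 p0' (congr1 (fun f => f _) e).
  by rewrite mulrN subrr eq_sym oner_eq0.
- move=> delta /lateral_chain_phases[] // C [S [C' [S' [ph e]]]].
  by rewrite (chain_area_phases _ _ _ ph) // e.
Qed.
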